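(* (Strong maximum principle.) Let $\Omega$ be a subgraph of a host graph with $\partial\Omega\neq\emptyset$, let $T>0$, let $k:\Omega\times[0,T]\to\mathbb{R}$ be bounded, and let $\mathcal{B}u=u$ or $\mathcal{B}u=\frac{\partial u}{\partial_\Omega n}$. Suppose $u\in C^1(\Omega\times(0,T])\cap C^0(\overline{\Omega}\times[0,T])$ satisfies $$u_t-\Delta_\Omega u+k(x,t)u\ge 0\ \text{ on }\Omega\times(0,T],\qquad \mathcal{B}u\ge 0\ \text{ on }\partial\Omega\times(0,T],\qquad u(x,0)=u_0(x)\ \text{ on }\Omega,$$ where $u_0\ge 0$ and $u_0\not\equiv 0$ on $\Omega$. If $\mathcal{B}u=u$, then $u(x,t)>0$ for $x\in\Omega$ and $t\in(0,T]$. If $\mathcal{B}u=\frac{\partial u}{\partial_\Omega n}$, then $u(x,t)>0$ for $x\in\overline{\Omega}$ and $t\in(0,T]$.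
   Context: The host graph $G=(V,E)$ is finite, undirected and connected, with weight $\omega:V\times V\to[0,\infty)$, $\omega_{xy}=\omega_{yx}$, $\omega_{xy}=0$ iff $xy\notin E$, and measure $\mu:V\to(0,\infty)$. $\Omega$ is a connected, simple, induced subgraph (identified with its vertex set); $\partial\Omega=\{z\in V\setminus\Omega: z\sim y\text{ for some }y\in\Omega\}$ and $\overline{\Omega}=\Omega\cup\partial\Omega$. For $x\in\Omega$, $\Delta_\Omega u(x)=\sum_{y\in\overline{\Omega}}(u(y)-u(x))\frac{\omega_{yx}}{\mu(x)}$ (acting in $x$). For $z\in\partial\Omega$, $\frac{\partial u}{\partial_\Omega n}(z)=\sum_{y\in\Omega}(u(z)-u(y))\frac{\omega_{zy}}{\mu(z)}$. For a vertex set $A$ and interval $I$, $C^n(A\times I)$ denotes functions $u$ with $u(x,\cdot)$ $n$ times continuously differentiable on $I$ for each $x\in A$ (one-sided at included endpoints). *)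

(* Defs.v *)
From HB Require Import structures.
From mathcomp Require Import all_boot all_order all_algebra.
From mathcomp Require Import all_classical all_reals all_analysis.

Set Implicit Arguments.
Unset Strict Implicit.
Unset Printing Implicit Defensive.

Import Order.TTheory GRing.Theory Num.Theory.
Import numFieldNormedType.Exports.

Local Open Scope classical_set_scope.
Local Open Scope ring_scope.

(* Loops are allowed in the host graph; only the subgraph is required to be
   simple. *)
Record host_graph (R : realType) (V : finType) := HostGraph {
  edge : rel V ;
  weight : V -> V -> R ;
  vmeasure : V -> R ;
  edge_sym : symmetric edge ;
  host_connected : forall x y, connect edge x y ;
  weight_ge0 : forall x y, 0 <= weight x y ;
  weight_sym : forall x y, weight x y = weight y x ;
  weight_eq0 : forall x y, weight x y = 0 <-> ~~ edge x y ;
  vmeasure_gt0 : forall x, 0 < vmeasure x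
}.

Section Graph.
Variables (R : realType) (V : finType) (G : host_graph R V).
Implicit Types (Omega : {set V}) (v : V -> R).

Definition induced_edge Omega : rel V :=
  [rel x y | [&& x \in Omega, y \in Omega & edge G x y]].

(* An induced subgraph is given by its vertex set, its edges being
   [induced_edge Omega]; multiple edges are excluded by the representation. *)
Definition connected_simple_subgraph Omega : Prop :=
  [/\ Omega != finset.set0,
      {in Omega &, forall x y, connect (induced_edge Omega) x y} &
      {in Omega, forall x, ~~ induced_edge Omega x x}].

Definition vboundary Omega : {set V} :=
  [set z : V | (z \notin Omega) && [exists y in Omega, edge G z y]]%SET.

Definition vclosure Omega : {set V} := (Omega :|: vboundary Omega)%SET.

Definition laplacian Omega v (x : V) : R :=
  \sum_(y in vclosure Omega) (v y - v x) * (weight G y x / vmeasure G x).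

Definition normal_derivative Omega v (z : V) : R :=
  \sum_(y in Omega) (v z - v y) * (weight G z y / vmeasure G z).

Variant boundary_type := Dirichlet | Neumann.

Definition boundary_op (B : boundary_type) Omega v (z : V) : R :=
  match B with
  | Dirichlet => v z
  | Neumann => normal_derivative Omega v z
  end.

End Graph.

Section Regularity.
Variable R : realType.
Implicit Types (I : interval R) (f : R -> R) (t : R).

(* Difference quotients at [t] along points of [I] other than [t]: the
   resulting derivative is two-sided in the interior of [I], one-sided at an
   endpoint belonging to [I], and ignores the values of [f] outside [I]. *)
Definition diff_quotient_on I f t : set_system R :=
  (f s - f t) / (s - t) @[s --> within [set` I] t^'].

Definition derivable_on I f t : Prop := cvg (diff_quotient_on I f t).

Definition derive_on I f t : R := lim (diff_quotient_on I f t).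

Fixpoint Cn_fun (n : nat) I f : Prop :=
  match n with
  | 0 => {within [set` I], continuous f}
  | m.+1 => {in I, forall t, derivable_on I f t} /\ Cn_fun m I (derive_on I f)
  end.

Definition Cn (V : finType) (n : nat) (A : {set V}) I (u : V -> R -> R) : Prop :=
  {in A, forall x, Cn_fun n I (u x)}.

End Regularity.

(* Main.v *)
Require Import Defs.
From HB Require Import structures.
From mathcomp Require Import all_boot all_order all_algebra.
From mathcomp Require Import all_classical all_reals all_analysis.
From mathcomp Require Import lra ring.

Set Implicit Arguments.
Unset Strict Implicit.
Unset Printing Implicit Defensive.

Import Order.TTheory GRing.Theory Num.Theory.
Import numFieldNormedType.Exports.

Local Open Scope ring_scope.

(** The proof rests on reading the differential inequality at a point where [u]
    touches a smooth curve from above. If [g <= f] up to time [t], with equality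
    at [t], the left difference quotients of [f] at [t] are at most those of
    [g], so [f' t <= g' t] ([derive_on_le_touching]). This is the only use of
    the differentiability of [u].

    Nonnegativity. Were [u] negative somewhere on [Omega], the minimum of
    [expR (- l * t) * u x t] over [x] in [Omega] and [0 <= t <= T], for [l] larger
    than a bound of [|k|], would be negative and attained at some [(x, t)] with
    [0 < t]. Touching [u x] by the exponential through that point gives
    [u_t <= l * u]. The boundary condition prevents [u] from going below
    [u x t] on the boundary at time [t], hence the Laplacian at [x] is
    nonnegative and the inequality forces [u_t >= - k * u], which exceeds
    [l * u]: a contradiction. [comparison_principle] isolates this argument
    for a finite family of functions of time lying over a barrier, and
    [weak_maximum_principle] is its instance with barrier [0].

    Strict positivity. Since [u] is now nonnegative on the closure, the
    Laplacian at [x] is at least [- D * u x] for a constant [D], so each single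
    [u x] satisfies [u_t >= - C * u]. The comparison principle, applied to the
    one function [u x] with barrier [u x 0 * expR (- C * t)], shows that a
    vertex positive at time [0] stays positive ([positivity_persists]). In the
    other direction, if [u x t = 0] with [x] in [Omega] and [0 < t], then
    [u x] touches the curve [0], so [u_t <= 0], the Laplacian at [x] is a
    vanishing sum of nonnegative terms, and [u] vanishes at all neighbours of
    [x] at time [t] ([zero_propagates]). As [Omega] is connected, [u] would
    vanish on all of [Omega] at time [t], including at a vertex where [u0] is
    positive. Under the Neumann condition, a boundary value is at least one of
    the interior values ([normal_derivative_ge0_dominates]), which carries
    positivity to the boundary. *)

(** * Touching and comparison for functions of time *)

(** Only left difference quotients are compared, so that the result also holds
    at [t = T], where the derivative is one-sided. *)
Lemma derive_on_le_touching (R : realType) (T t dg : R) (f g : R -> R) :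
    t \in `]0, T] -> derivable_on `]0, T] f t -> is_derive t 1 g dg ->
    (forall s, s \in `]0, t] -> g s <= f s) -> f t = g t ->
  derive_on `]0, T] f t <= dg.
Proof.
rewrite in_itv /= => /andP[t0 tT] df gdg gf ft.
have [c [cE cc ct]] := (is_derive1_caratheodory g t dg).1 gdg.
(* The left neighbourhoods of [t] are among those that define [derive_on],
   because [0 < t <= T]. *)
have left_sub : (t^'- --> within [set` `]0, T]%R] t^')%classic.
  move=> A; rewrite /nbhs /= /at_left /dnbhs /within /= => wA.
  apply: filterS2 (lt_nbhsr t0) wA => s s0 + st; apply.
    by rewrite lt_eqF.
  by rewrite in_itv/= s0 (le_trans (ltW st)).
have fE := cvg_trans (cvg_app (fun s => (f s - f t) / (s - t)) left_sub) df.
have gE : (c @ t^'- --> dg)%classic.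
  by rewrite -ct; apply: cvg_at_left_filter.
apply: (ler_cvg_to fE gE); near=> s.
have st : s < t by near: s; exact: nbhs_left_lt.
have s0 : 0 < s by near: s; exact: nbhs_left_gt.
rewrite ler_ndivrMr ?subr_lt0// -cE ft lerB ?gf// in_itv/= s0/=.
exact: ltW.
Unshelve. all: by end_near.
Qed.

(** The derivative is written as the factor [l] times the perturbation because
    the comparison argument uses that value against [f - g] at the touching
    point. *)
Lemma is_derive_barrier (R : realType) (g : R -> R) (dg m l t : R) :
  is_derive t 1 g dg ->
  is_derive t 1 (fun s => g s + m * expR (l * s)) (dg + l * (m * expR (l * t))).
Proof.
move=> gdg; apply: is_deriveD.
have h : is_derive t 1 (fun s : R => l * s) l.
  by apply: is_derive_eq (mulr1 l).
have H := is_derive1_comp (is_derive_expR (l * t)) h.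
have H2 := is_deriveZ m H.
apply: is_derive_eq H2 _.
rewrite /GRing.scale /=; ring.
Qed.

Lemma finite_family_EVT_min (R : realType) (V : finType) (A : {set V}) (a b : R)
    (h : V -> R -> R) : A != finset.set0 -> a <= b ->
    {in A, forall i, {within `[a, b], continuous (h i)}%classic} ->
  exists i t, [/\ i \in A, t \in `[a, b] &
    forall j s, j \in A -> s \in `[a, b] -> h i t <= h j s].
Proof.
move=> /set0Pn[i0 Ai0] ab hc.
have /choice[c cP] : forall i, exists c, i \in A ->
    c \in `[a, b] /\ forall s, s \in `[a, b] -> h i c <= h i s.
  move=> i; have [Ai|_] := boolP (i \in A); last by exists a.
  by have [c cab cmin] := EVT_min ab (hc i Ai); exists c.
case: (arg_minP (fun i => h i (c i)) Ai0) => i Ai imin.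
exists i, (c i); split=> //; first by case: (cP i Ai).
move=> j s Aj sab; apply: le_trans (imin j Aj) _.
by case: (cP j Aj) => _; apply.
Qed.

(** At a negative minimum of the weighted gaps [expR (- (L + 1) * s) * (f i s - g s)]
    the function [f i] touches [g] plus a multiple of [expR ((L + 1) * s)], whence
    [f' - g' <= (L + 1) * (f - g) < L * (f - g)]. The differential inequality is
    therefore only required where the gap [f i - g] is negative and minimal in
    the family at that time; this is where a Laplacian has a sign. *)
Lemma comparison_principle (R : realType) (V : finType) (A : {set V}) (T L : R)
    (f : V -> R -> R) (g dg : R -> R) :
    0 <= T -> Cn 1 A `]0, T] f -> Cn 0 A `[0, T] f ->
    (forall t : R, is_derive t 1 g (dg t)) ->
    (forall i, i \in A -> g 0 <= f i 0) ->
    (forall i t, i \in A -> t \in `]0, T] -> f i t < g t ->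
       (forall j, j \in A -> f i t <= f j t) ->
       L * (f i t - g t) <= derive_on `]0, T] (f i) t - dg t) ->
  forall i t, i \in A -> t \in `[0, T] -> g t <= f i t.
Proof.
move=> T0 fC1 fC0 gdg f0 fmin i1 t1 Ai1 t1T.
(* The rate is [L + 1] rather than [L] to make the final inequality strict. *)
pose h i s := expR (- (L + 1) * s) * (f i s - g s).
have A0 : A != finset.set0 by apply/set0Pn; exists i1.
have hc : {in A, forall i, {within `[0, T], continuous (h i)}%classic}.
  move=> i Ai x; apply: cvgM.
    apply: (@continuous_subspaceT _ _ _ (fun s : R => expR (- (L + 1) * s))) => y.
    apply: (@continuous_comp _ _ _ (fun s : R => - (L + 1) * s) expR).
      exact: mulrl_continuous.
    exact: continuous_expR.
  apply: cvgB; first exact: (fC0 i Ai).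
  apply: (@continuous_subspaceT _ _ _ g) => y.
  apply: differentiable_continuous; apply/derivable1_diffP.
  by case: (gdg y).
have [i [t [Ai tT hmin]]] := finite_family_EVT_min A0 T0 hc.
have hexp : forall j s, f j s = g s + h j s * expR ((L + 1) * s).
  move=> j s; rewrite /h mulrAC -expRD mulNr addNr expR0 mul1r.
  by rewrite addrC subrK.
have [h_ge0|h_lt0] := leP 0 (h i t).
  rewrite hexp lerDl mulr_ge0 ?expR_ge0//.
  exact: le_trans h_ge0 (hmin _ _ Ai1 t1T).
exfalso.
have fg : f i t < g t by rewrite hexp gtrDl nmulr_rlt0 ?expR_gt0.
have t_neq0 : t != 0.
  by apply: contraTneq fg => ->; rewrite -leNgt f0.
have tT' : t \in `]0, T].
  by move: tT; rewrite !in_itv/= lt_neqAle eq_sym t_neq0.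
have fij j : j \in A -> f i t <= f j t.
  move=> Aj; rewrite !hexp lerD2l ler_pM2r ?expR_gt0//.
  exact: hmin.
have := fmin i t Ai tT' fg fij.
have dle : derive_on `]0, T] (f i) t <= dg t + (L + 1) * (f i t - g t).
  have -> : f i t - g t = h i t * expR ((L + 1) * t).
    by rewrite hexp addrAC subrr add0r.
  apply: (derive_on_le_touching tT' _ (is_derive_barrier _ _ (gdg t))).
  - by case: (fC1 i Ai) => + _; apply.
  - move=> s; rewrite in_itv/= => /andP[s0 st].
    rewrite hexp lerD2l ler_pM2r ?expR_gt0// hmin// in_itv/= ltW//=.
    by move: tT; rewrite in_itv/= => /andP[_]; exact: le_trans.
  - by rewrite hexp.
have : f i t - g t < 0 by rewrite subr_lt0.
by move: dle; rewrite mulrDl; lra.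
Qed.

(** * Boundary conditions and the Laplacian at a minimum *)

Section Positivity.
Variables (R : realType) (V : finType) (G : host_graph R V) (Omega : {set V}).

Definition out_flow (x : V) : R :=
  \sum_(y in vclosure G Omega) weight G y x / vmeasure G x.

Lemma conductance_ge0 x y z : 0 <= weight G x y / vmeasure G z.
Proof. by rewrite divr_ge0 ?weight_ge0// ltW// vmeasure_gt0. Qed.

Lemma conductance_gt0 x y z : edge G x y -> 0 < weight G x y / vmeasure G z.
Proof.
move=> xy; rewrite divr_gt0 ?vmeasure_gt0// lt_neqAle weight_ge0 andbT eq_sym.
by apply/eqP => /weight_eq0; rewrite xy.
Qed.

Lemma vclosureE x : (x \in vclosure G Omega) =
  (x \in Omega) || (x \in vboundary G Omega).
Proof. exact: finset.in_setU. Qed.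

Lemma boundary_neighbour z : z \in vboundary G Omega ->
  exists2 y, y \in Omega & edge G z y.
Proof. by rewrite finset.inE => /andP[_ /existsP[y /andP[]]]; exists y. Qed.

(** Otherwise every term of the normal derivative is nonpositive, and the term
    of a neighbour of [z] in [Omega] is negative. *)
Lemma normal_derivative_ge0_dominates v z : z \in vboundary G Omega ->
    0 <= normal_derivative G Omega v z ->
  exists2 y, y \in Omega & v y <= v z.
Proof.
move=> /boundary_neighbour[y0 y0O zy0] dv; apply/exists_inP.
move: dv; apply: contraTT; rewrite negb_exists_in => /forall_inP vz.
have neg y : y \in Omega -> v z - v y < 0.
  by move=> /vz; rewrite -ltNge subr_lt0.
rewrite -ltNge /normal_derivative (bigD1 y0)//= -[ltRHS]addr0.
rewrite ltr_leD ?nmulr_rlt0 ?neg ?conductance_gt0//.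
apply: sumr_le0 => y /andP[yO _].
by rewrite mulr_le0_ge0 ?conductance_ge0// ltW// neg.
Qed.

(** The sign condition on [c] is what lets both boundary conditions be treated
    alike: Dirichlet data only bound [v z] below by [0]. *)
Lemma boundary_op_lower_bound B v c z : z \in vboundary G Omega ->
    0 <= boundary_op G B Omega v z -> c <= 0 ->
    {in Omega, forall y, c <= v y} -> c <= v z.
Proof.
move=> bz; case: B => /= [vz c0 _|dv _ cv]; first exact: le_trans c0 vz.
have [y yO] := normal_derivative_ge0_dominates bz dv.
by apply: le_trans; exact: cv.
Qed.

Lemma closure_lower_bound B v c :
    {in vboundary G Omega, forall z, 0 <= boundary_op G B Omega v z} ->
    c <= 0 -> {in Omega, forall y, c <= v y} ->
  {in vclosure G Omega, forall y, c <= v y}.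
Proof.
move=> bv c0 cv y; rewrite vclosureE => /orP[|yb]; first exact: cv.
exact: (boundary_op_lower_bound yb (bv y yb)).
Qed.

Lemma laplacian_min_ge0 v x :
  {in vclosure G Omega, forall y, v x <= v y} -> 0 <= laplacian G Omega v x.
Proof.
move=> vx; apply: sumr_ge0 => y yO.
by rewrite mulr_ge0 ?subr_ge0 ?vx ?conductance_ge0.
Qed.

(** Dropping the nonnegative inflow [v y] leaves only the loss at [x] itself. *)
Lemma laplacian_ge_out_flow v x : {in vclosure G Omega, forall y, 0 <= v y} ->
  - out_flow x * v x <= laplacian G Omega v x.
Proof.
move=> v0; rewrite mulNr mulrC -mulrN /out_flow -sumrN mulr_sumr.
apply: ler_sum => y yO; rewrite mulrN -mulNr.
by rewrite ler_wpM2r ?conductance_ge0// lerDr v0.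
Qed.

Lemma laplacian_min_eq v x y :
    {in vclosure G Omega, forall y, v x <= v y} -> laplacian G Omega v x <= 0 ->
    y \in vclosure G Omega -> edge G x y -> v y = v x.
Proof.
move=> vx lap0 yO xy.
have term_ge0 z : z \in vclosure G Omega ->
    0 <= (v z - v x) * (weight G z x / vmeasure G x).
  by move=> zO; rewrite mulr_ge0 ?subr_ge0 ?vx ?conductance_ge0.
have lapE : laplacian G Omega v x = 0.
  by apply/eqP; rewrite eq_le lap0 laplacian_min_ge0.
have /eqP := psumr_eq0P term_ge0 lapE yO.
rewrite mulf_eq0 [X in _ || X]gt_eqF ?orbF ?subr_eq0; first by move/eqP.
by rewrite conductance_gt0// edge_sym.
Qed.

Lemma connected_set_ind (P : V -> Prop) x :
    {in Omega &, forall x y, connect (induced_edge G Omega) x y} ->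
    x \in Omega -> P x ->
    (forall y z, y \in Omega -> z \in Omega -> edge G y z -> P y -> P z) ->
  {in Omega, forall y, P y}.
Proof.
move=> conn xO Px step y yO; have /connectP[p + ->] := conn x y xO yO.
elim: p x {xO} Px => //= z p IHp x Px /andP[/and3P[xO zO xz] zp].
exact: IHp (step x z xO zO xz Px) zp.
Qed.

(** * Positivity of supersolutions *)

Variables (T M : R) (k u : V -> R -> R) (B : boundary_type).
Hypothesis T_gt0 : 0 < T.
Hypothesis k_le : forall x t, x \in Omega -> t \in `[0, T] -> `|k x t| <= M.
Hypothesis uC1 : Cn 1 Omega `]0, T] u.
Hypothesis uC0 : Cn 0 Omega `[0, T] u.
Hypothesis pde : forall x t, x \in Omega -> t \in `]0, T] ->
  0 <= derive_on `]0, T] (u x) t - laplacian G Omega (u ^~ t) x + k x t * u x t.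
Hypothesis bdry : forall z t, z \in vboundary G Omega -> t \in `]0, T] ->
  0 <= boundary_op G B Omega (u ^~ t) z.
Hypothesis init_ge0 : forall x, x \in Omega -> 0 <= u x 0.

Lemma reaction_le x t : x \in Omega -> t \in `]0, T] ->
  k x t * u x t <= M * `|u x t|.
Proof.
move=> xO tT; apply: le_trans (ler_norm _) _.
rewrite normrM ler_wpM2r// k_le//.
by move: tT; rewrite !in_itv/= => /andP[/ltW-> ->].
Qed.

(** Comparison with the barrier [0] and rate [M]: at a negative minimum the
    Laplacian is nonnegative and [- k * u >= M * u]. *)
Lemma weak_maximum_principle x t : x \in Omega -> t \in `[0, T] -> 0 <= u x t.
Proof.
move: x t; apply: (@comparison_principle _ _ _ T M _ (cst 0) (cst 0)) => //.
  exact: ltW.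
move=> x t xO tT ux umin /=; rewrite !subr0.
have lap : 0 <= laplacian G Omega (u ^~ t) x.
  apply: laplacian_min_ge0.
  by apply: (@closure_lower_bound B _ (u x t)) => // [z /bdry|]; [exact|exact: ltW].
have := pde xO tT; have := reaction_le xO tT.
by rewrite ltr0_norm// mulrN; lra.
Qed.

Lemma closure_ge0 x t : x \in vclosure G Omega -> t \in `]0, T] -> 0 <= u x t.
Proof.
move=> xO tT; move: x xO.
apply: (@closure_lower_bound B (u ^~ t)) => // [z /bdry|x xO]; first exact.
apply: weak_maximum_principle => //.
by move: tT; rewrite !in_itv/= => /andP[/ltW-> ->].
Qed.

(** Once [u] is known to be nonnegative, the neighbours of [x] can only help, and
    [u x] decays at most exponentially. This is comparison for a family
    reduced to [x], with the barrier [u x 0 * expR (- C * s)]. *)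
Lemma positivity_persists x t : x \in Omega -> 0 < u x 0 -> t \in `]0, T] ->
  0 < u x t.
Proof.
move=> xO ux0 tT; pose C := out_flow x + M.
(* The summand [0] presents [g] as a perturbation of the zero curve, the form of
   [is_derive_barrier]. *)
pose g s := 0 + u x 0 * expR (- C * s).
suff : g t <= u x t.
  by apply: lt_le_trans; rewrite /g add0r mulr_gt0 ?expR_gt0.
have xx : x \in [set x]%SET by rewrite finset.inE.
have sub n I : Cn n Omega I u -> Cn n [set x]%SET I u.
  by move=> h y; rewrite finset.inE => /eqP->; exact: h.
apply: (@comparison_principle _ _ [set x]%SET T (- C) u g
  (fun s => 0 + - C * (u x 0 * expR (- C * s)))) => //.
- exact: ltW.
- exact: sub.
- exact: sub.
- by move=> s; apply: is_derive_barrier.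
- move=> y; rewrite finset.inE => /eqP->.
  by rewrite /g mulr0 expR0 mulr1 add0r.
- move=> y s; rewrite finset.inE => /eqP-> sT _ _.
  have u_ge0 y' : y' \in vclosure G Omega -> 0 <= u y' s.
    by move=> y'O; exact: closure_ge0.
  have := laplacian_ge_out_flow x u_ge0.
  have := pde xO sT; have := reaction_le xO sT.
  rewrite ger0_norm ?u_ge0 ?vclosureE ?xO//.
  rewrite /g !add0r /C; lra.
- by move: tT; rewrite !in_itv/= => /andP[/ltW-> ->].
Qed.

(** At an interior zero [u x] touches the curve [0] from above, so [u_t <= 0];
    the inequality then makes the Laplacian nonpositive at a minimum, where
    all its terms are nonnegative. *)
Lemma zero_propagates x y t : x \in Omega -> t \in `]0, T] -> u x t = 0 ->
  y \in vclosure G Omega -> edge G x y -> u y t = 0.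
Proof.
move=> xO tT ux yO xy; rewrite -ux.
apply: (@laplacian_min_eq (u ^~ t) x y) => // [z zO|].
  by rewrite ux closure_ge0.
have : derive_on `]0, T] (u x) t <= 0.
  apply: (@derive_on_le_touching _ T t 0 (u x) (cst 0)) => //.
    by case: (uC1 xO) => + _; apply.
  move=> s; rewrite in_itv/= => /andP[s0 st].
  apply: closure_ge0; first by rewrite vclosureE xO.
  by move: tT; rewrite !in_itv/= s0 => /andP[_]; exact: le_trans.
by have := pde xO tT; rewrite ux mulr0; lra.
Qed.

(** A zero at time [t] would spread over the connected [Omega], up to a vertex
    that is positive initially and hence at time [t]. *)
Lemma interior_positivity :
    {in Omega &, forall x y, connect (induced_edge G Omega) x y} ->
    (exists2 x, x \in Omega & 0 < u x 0) ->
  forall x t, x \in Omega -> t \in `]0, T] -> 0 < u x t.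
Proof.
move=> conn [x1 x1O ux1] x t xO tT.
rewrite lt_neqAle closure_ge0 ?vclosureE ?xO// andbT; apply/eqP => /esym ux.
suff /(_ x1 x1O) ux1t : {in Omega, forall y, u y t = 0}.
  by have := positivity_persists x1O ux1 tT; rewrite ux1t ltxx.
apply: (connected_set_ind conn xO) => // y z yO zO yz uy.
by apply: (zero_propagates yO tT uy _ yz); rewrite vclosureE zO.
Qed.

End Positivity.

(** * The strong maximum principle *)

Theorem theorem3p5 (R : realType) (V : finType) (G : host_graph R V)
    (Omega : {set V}) (T : R) (k : V -> R -> R) (B : boundary_type)
    (u : V -> R -> R) (u0 : V -> R)
    (hOmega : connected_simple_subgraph G Omega)
    (hboundary : vboundary G Omega != finset.set0)
    (hT : 0 < T)
    (hk : exists M : R, forall x t, x \in Omega -> t \in `[0, T] ->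
            `|k x t| <= M)
    (hC1 : Cn 1 Omega `]0, T] u)
    (hC0 : Cn 0 (vclosure G Omega) `[0, T] u)
    (hpde : forall x t, x \in Omega -> t \in `]0, T] ->
       0 <= derive_on `]0, T] (u x) t - laplacian G Omega (u ^~ t) x
            + k x t * u x t)
    (hbdry : forall z t, z \in vboundary G Omega -> t \in `]0, T] ->
       0 <= boundary_op G B Omega (u ^~ t) z)
    (hinit : forall x, x \in Omega -> u x 0 = u0 x)
    (hu0_ge0 : forall x, x \in Omega -> 0 <= u0 x)
    (hu0_neq0 : exists2 x, x \in Omega & u0 x != 0) :
  (B = Dirichlet ->
     forall x t, x \in Omega -> t \in `]0, T] -> 0 < u x t) /\
  (B = Neumann ->
     forall x t, x \in vclosure G Omega -> t \in `]0, T] -> 0 < u x t).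
Proof.
have [M k_le] := hk; have [_ conn _] := hOmega.
have uC0 : Cn 0 Omega `[0, T] u.
  by move=> x xO; apply: hC0; rewrite vclosureE xO.
have init_ge0 x : x \in Omega -> 0 <= u x 0 by move=> xO; rewrite hinit// hu0_ge0.
have init_gt0 : exists2 x, x \in Omega & 0 < u x 0.
  have [x xO ux] := hu0_neq0; exists x => //.
  by rewrite hinit// lt_neqAle eq_sym ux hu0_ge0.
have u_gt0 := interior_positivity hT k_le hC1 uC0 hpde hbdry init_ge0 conn init_gt0.
split=> [_|BN x t]; first exact: u_gt0.
rewrite vclosureE => /orP[xO tT|xb tT]; first exact: u_gt0.
have := hbdry x t xb tT; rewrite BN /= => dv.
have [y yO] := normal_derivative_ge0_dominates xb dv.
by apply: lt_le_trans; exact: u_gt0.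
Qed.
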